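(* Let $\Gamma$ be a finite simple connected graph with $d+1\ge 2$ distinct eigenvalues $\lambda_0>\lambda_1>\cdots>\lambda_d$ of multiplicities $m_0,\ldots,m_d$, with $n$ vertices and adjacency matrix $A$. For $\ell=0,1,2,\ldots$ let $$c(\ell)=\frac1n\operatorname{tr}(A^\ell)=\frac1n\sum_{i=0}^d m_i\lambda_i^\ell$$ be the average number of closed walks of length $\ell$. Then the preintersection numbers $\alpha_i,\beta_i,\gamma_i$ of $\Gamma$ can be computed directly from the spectrum of $\Gamma$ by using the numbers $c(\ell)$ (together with $\lambda_0$), and their first values are: $$\alpha_0=0,\qquad \beta_0=\lambda_0,$$ $$\gamma_1=\frac{c(2)}{\lambda_0},\qquad \alpha_1=\frac{c(3)}{c(2)},\qquad \beta_1=\lambda_0-\alpha_1-\gamma_1,$$ and, if $d\ge 2$, $$\gamma_2=\frac{\lambda_0\,[c(2)c(4)-c(3)^2-c(2)^3]}{c(2)\,[\lambda_0^2c(2)-c(3)\lambda_0-c(2)^2]},\qquad \alpha_2=\frac{c(2)^2c(5)-2c(2)c(3)c(4)+c(3)^3}{c(2)\,[c(2)c(4)-c(3)^2-c(2)^3]}.$$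
   Context: The predistance polynomials $p_0,\ldots,p_d\in\mathbb{R}[x]$ of $\Gamma$ are the unique polynomials with $\deg p_i=i$ that are orthogonal with respect to $\langle f,g\rangle_\Gamma=\frac1n\operatorname{tr}(f(A)g(A))=\frac1n\sum_{i=0}^d m_i f(\lambda_i)g(\lambda_i)$ and normalized so that $\|p_i\|_\Gamma^2=p_i(\lambda_0)$. The preintersection numbers $\alpha_i,\beta_i,\gamma_i$ considered are the coefficients of the three-term recurrence $xp_i=\beta_{i-1}p_{i-1}+\alpha_ip_i+\gamma_{i+1}p_{i+1}$, $i=0,\ldots,d$, with $\beta_{-1}=\gamma_{d+1}=0$ (for $i\le d-1$ an identity of polynomials; for $i=d$ an identity modulo the minimal polynomial $\prod_{i=0}^d(x-\lambda_i)$ of $A$); by convention $\beta_d=0$. *)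

(* Defs.v *)
From HB Require Import structures.
From mathcomp Require Import all_boot all_order all_algebra.
From mathcomp Require Import mpoly.

Set Implicit Arguments.
Unset Strict Implicit.
Unset Printing Implicit Defensive.

Import Order.TTheory GRing.Theory Num.Theory.

Local Open Scope ring_scope.

(* The vertex set is 'I_n.+1, so a graph below has n.+1 vertices; the successor
   makes the square matrices a nontrivial ring, as [horner_mx] requires. *)
Definition connected_simple_graph (n : nat) (e : rel 'I_n.+1) : Prop :=
  [/\ ssrbool.symmetric e, irreflexive e & forall x y, connect e x y].

Definition adjacency (R : rcfType) (n : nat) (e : rel 'I_n.+1) : 'M[R]_n.+1 :=
  \matrix_(i, j) (e i j)%:R.

Definition has_spectrum (R : rcfType) (n d : nat) (A : 'M[R]_n.+1)
    (lam : 'I_d.+1 -> R) (m : 'I_d.+1 -> nat) : Prop :=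
  [/\ forall i j : 'I_d.+1, (i < j)%N -> lam j < lam i,
      forall i, (0 < m i)%N
    & char_poly A = \prod_(i < d.+1) ('X - (lam i)%:P) ^+ m i].

Definition closed_walks (R : rcfType) (n : nat) (A : 'M[R]_n.+1) (l : nat) : R :=
  n.+1%:R^-1 * \tr (A ^+ l).

Definition graph_ip (R : rcfType) (n : nat) (A : 'M[R]_n.+1) (f g : {poly R}) : R :=
  n.+1%:R^-1 * \tr (horner_mx A f *m horner_mx A g).

(* Only p 0, ..., p d are constrained. *)
Definition predistance_polynomials (R : rcfType) (n d : nat) (A : 'M[R]_n.+1)
    (lam : 'I_d.+1 -> R) (p : nat -> {poly R}) : Prop :=
  [/\ forall i, (i <= d)%N -> size (p i) = i.+1,
      forall i j, (i <= d)%N -> (j <= d)%N -> i != j ->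
        graph_ip A (p i) (p j) = 0
    & forall i, (i <= d)%N -> graph_ip A (p i) (p i) = (p i).[lam ord0]].

Definition minimal_polynomial (R : rcfType) (d : nat) (lam : 'I_d.+1 -> R)
    : {poly R} :=
  \prod_(i < d.+1) ('X - (lam i)%:P).

(* The term beta_{i-1} p_{i-1} of the recurrence, with beta_{-1} = 0. *)
Definition lower_term (R : rcfType) (p : nat -> {poly R}) (beta : nat -> R)
    (i : nat) : {poly R} :=
  if i is j.+1 then beta j *: p j else 0.

(* The convention gamma_{d+1} = 0 is rendered by the absence of the upper term
   in the last recurrence; gamma 0 is unconstrained. *)
Definition preintersection_numbers (R : rcfType) (d : nat) (lam : 'I_d.+1 -> R)
    (p : nat -> {poly R}) (alpha beta gamma : nat -> R) : Prop :=
  [/\ forall i, (i < d)%N ->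
        'X * p i = lower_term p beta i + alpha i *: p i + gamma i.+1 *: p i.+1,
      minimal_polynomial lam
        %| 'X * p d - (lower_term p beta d + alpha d *: p d)
    & beta d = 0].

(* A quotient of two polynomials with integer coefficients in the variables
   lambda_0 (number 0) and c(0), ..., c(N-1) (numbers 1, ..., N), where N is
   [rf_walks]. *)
Record ratfun := RatFun {
  rf_walks : nat;
  rf_num : {mpoly int[rf_walks.+1]};
  rf_den : {mpoly int[rf_walks.+1]}
}.

Definition ratfun_args (R : rcfType) (N : nat) (lam0 : R) (c : nat -> R)
    (k : 'I_N.+1) : R :=
  if val k is l.+1 then c l else lam0.

Definition ratfun_eval (R : rcfType) (N : nat) (P : {mpoly int[N.+1]})
    (lam0 : R) (c : nat -> R) : R :=
  mmap (fun z : int => z%:~R) (@ratfun_args R N lam0 c) P.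

(* x is the value of F, whose denominator does not vanish there. *)
Definition computed_by (R : rcfType) (F : ratfun) (lam0 : R) (c : nat -> R)
    (x : R) : Prop :=
  ratfun_eval (rf_den F) lam0 c != 0 /\
  x = ratfun_eval (rf_num F) lam0 c / ratfun_eval (rf_den F) lam0 c.

(* Main.v *)
Require Import Defs.
From HB Require Import structures.
From mathcomp Require Import all_boot all_order all_algebra.
From mathcomp Require Import complex.
From mathcomp Require Import mpoly.
From mathcomp Require Import ring.

Set Implicit Arguments.
Unset Strict Implicit.
Unset Printing Implicit Defensive.

Import Order.TTheory GRing.Theory Num.Theory.

Local Open Scope ring_scope.

(** Everything about the predistance polynomials is encoded by two data: the
moment functional [L] on polynomials with [L 'X^l = c l], and the point
[lam0].  The inner product is [<f, g> = L (f * g)], because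
[f(A) g(A) = (f g)(A)].

Multiplication by ['X] is self-adjoint for this product, and
[<p_i, p_i> = p_i(lam0)].  Hence pairing the three-term recurrence with [p_i]
and [p_{i+1}] gives [<'X p_i, p_i> = alpha_i p_i(lam0)] ([alpha_norm]) and
[gamma_{i+1} p_{i+1}(lam0) = beta_i p_i(lam0)] ([beta_norm]).  Evaluating the
recurrence at [lam0] and simplifying with the second identity leaves
[lam0 = alpha_i + beta_i + gamma_i] ([beta_eq]).  Finally, put
[q_i = 'X p_i - beta_{i-1} p_{i-1} - alpha_i p_i = gamma_{i+1} p_{i+1}]; the
normalization of [p_{i+1}] says [L (q_i ^ 2) = gamma_{i+1} q_i(lam0)], that is,
[gamma_{i+1} = L (q_i ^ 2) / q_i(lam0)] ([gamma_eq]).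

So [p_0 = 1, alpha_0, beta_0, gamma_1, p_1, alpha_1, ...] are obtained in turn
from [lam0] and the [c l] by field operations, with formulas that depend
neither on the graph nor on [d].  Only two kinds of divisor occur, [p_i(lam0)]
and [q_i(lam0)].  The first is [<p_i, p_i>], which is nonzero because
[<f, f>] is the average of the [f(lam_i) ^ 2] with positive weights
[m_i], so that it vanishes only if [f] has the [d+1] roots [lam_i]; the second
is [gamma_{i+1} p_{i+1}(lam0)], nonzero since moreover [deg ('X p_i) = i+1].
Running this procedure by induction on [i] on formal fractions
([rational_recurrence]) gives the rational functions, and running it by hand
for [i <= 2] gives the displayed values.

The one fact needed from linear algebra is
[tr (A ^ l) = sum_i m_i lam_i ^ l]; it follows from Schur triangularization
over the complexification of the real closed field. *)

(** * Traces of powers and the spectrum *)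

Lemma char_poly_conj (F : fieldType) (n : nat) (P A : 'M[F]_n) :
  P \in unitmx -> char_poly (P *m A *m invmx P) = char_poly A.
Proof.
move=> uP; pose Q := map_mx (@polyC F) P.
pose Q' := map_mx (@polyC F) (invmx P).
have QQ' : Q *m Q' = 1%:M by rewrite -map_mxM mulmxV // map_mx1.
rewrite /char_poly.
have -> : char_poly_mx (P *m A *m invmx P) = Q *m char_poly_mx A *m Q'.
  rewrite /char_poly_mx mulmxBr mulmxBl !map_mxM; congr (_ - _).
  by rewrite scalar_mxC -mulmxA QQ' mulmx1.
by rewrite !det_mulmx mulrAC -det_mulmx QQ' det1 mul1r.
Qed.

Lemma trig_mxX (F : fieldType) (n : nat) (T : 'M[F]_n.+1) (l : nat) :
  is_trig_mx T ->
  is_trig_mx (T ^+ l) /\ forall i, (T ^+ l) i i = T i i ^+ l.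
Proof.
move=> /is_trig_mxP Ttrig; elim: l => [|l [/is_trig_mxP IHt IHd]].
  by rewrite expr0 scalar_mx_is_trig; split=> // i; rewrite expr0 mxE eqxx.
rewrite exprS; split=> [|i].
  apply/is_trig_mxP => i j ij; rewrite mxE big1 // => k _.
  have [ik|ki] := ltnP i k; first by rewrite Ttrig ?mul0r.
  by rewrite IHt ?mulr0 // (leq_ltn_trans ki).
rewrite mxE (bigD1 i) //= big1 ?addr0 ?IHd -?exprS // => k kni.
case: (ltngtP i k) => [ik|ki|/val_inj ik]; last by rewrite ik eqxx in kni.
  by rewrite Ttrig ?mul0r.
by rewrite IHt ?mulr0.
Qed.

(** A triangular matrix similar to [A] has the same characteristic polynomial,
so that its diagonal is [rs] up to order, and the diagonal of its [l]-th power
consists of the [r ^+ l]. *)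
Lemma trace_exp_closed (C : numClosedFieldType) (n : nat) (A : 'M[C]_n.+1)
    (rs : seq C) (l : nat) :
  char_poly A = \prod_(r <- rs) ('X - r%:P) ->
  \tr (A ^+ l) = \sum_(r <- rs) r ^+ l.
Proof.
move=> chiA; have [//|P /unitarymx_unit uP PA] := @spectral.Schur C n.+1 A.
pose T := P *m A *m invmx P.
have Ttrig : is_trig_mx T by move: PA; rewrite /similar_to conjumx.
have TX : T ^+ l = P *m A ^+ l *m invmx P.
  elim: l => [|l IHl]; first by rewrite !expr0 mulmx1 mulmxV.
  by rewrite !exprS IHl /T -!mulmxE !mulmxA mulmxKV.
have -> : \tr (A ^+ l) = \tr (T ^+ l).
  by rewrite TX mxtrace_mulC mulmxA mulVmx // mul1mx.
have /prod_XsubC_eq perm_rs :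
    \prod_(r <- [seq T i i | i : 'I_n.+1]) ('X - r%:P)
      = \prod_(r <- rs) ('X - r%:P).
  by rewrite -chiA -(char_poly_conj A uP) char_poly_trig // big_image.
rewrite -(perm_big _ perm_rs) big_image /=.
by apply: eq_bigr => i _; have [_ ->] := trig_mxX l Ttrig.
Qed.

(** Triangularization takes place over the algebraically closed field [R[i]],
where the roots of the characteristic polynomial are still the [lam i]. *)
Lemma trace_exp_spectrum (R : rcfType) (n d : nat) (A : 'M[R]_n.+1)
    (lam : 'I_d.+1 -> R) (m : 'I_d.+1 -> nat) (l : nat) :
  char_poly A = \prod_(i < d.+1) ('X - (lam i)%:P) ^+ m i ->
  \tr (A ^+ l) = \sum_(i < d.+1) (m i)%:R * lam i ^+ l.
Proof.
move=> chiA; pose iota := (real_complex R : {rmorphism R -> R[i]}).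
apply: (fmorph_inj iota); rewrite -trace_map_mx rmorphXn /=.
rewrite (@trace_exp_closed _ _ _
  (flatten [seq nseq (m i) (iota (lam i)) | i <- enum 'I_d.+1])) => [|].
  rewrite big_flatten big_map big_enum /= rmorph_sum /=.
  apply: eq_bigr => i _; rewrite big_nseq iter_addr_0.
  by rewrite rmorphM rmorph_nat rmorphXn mulr_natl.
rewrite -map_char_poly chiA rmorph_prod /= big_flatten big_map big_enum /=.
apply: eq_bigr => i _; rewrite big_nseq iter_mulr_1 rmorphXn /=.
by rewrite rmorphB /= map_polyX map_polyC.
Qed.

(** * The moment functional *)

Definition moment (R : rcfType) (c : nat -> R) (f : {poly R}) : R :=
  \sum_(k < size f) f`_k * c k.

Lemma moment_wide (R : rcfType) (c : nat -> R) (f : {poly R}) (n : nat) :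
  (size f <= n)%N -> moment c f = \sum_(k < n) f`_k * c k.
Proof.
move=> le_fn; rewrite /moment (big_ord_widen n (fun k => f`_k * c k) le_fn).
rewrite big_mkcond; apply: eq_bigr => k _.
by case: ltnP => // ge_k; rewrite nth_default ?mul0r.
Qed.

Lemma moment_is_linear (R : rcfType) (c : nat -> R) :
  linear_for *%R (moment c).
Proof.
move=> a f g; pose n := maxn (size (a *: f + g)) (maxn (size f) (size g)).
rewrite !(@moment_wide _ _ _ n) ?leq_max ?leqnn ?orbT // mulr_sumr -big_split.
by apply: eq_bigr => k _; rewrite /= coefD coefZ mulrDl mulrA.
Qed.

HB.instance Definition _ (R : rcfType) (c : nat -> R) :=
  GRing.isLinear.Build R {poly R} R *%R (moment c) (moment_is_linear c).

Lemma momentCXn (R : rcfType) (c : nat -> R) (a : R) (k : nat) :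
  moment c (a%:P * 'X^k) = a * c k.
Proof.
rewrite mul_polyC linearZ /=; congr (_ * _).
rewrite (@moment_wide _ _ _ k.+1) ?size_polyXn // big_ord_recr /=.
rewrite coefXn eqxx mul1r big1 ?add0r // => j _.
by rewrite coefXn (ltn_eqF (ltn_ord j)) mul0r.
Qed.

Section GraphMoments.

Variables (R : rcfType) (n d : nat) (A : 'M[R]_n.+1).

Lemma graph_ipE (f g : {poly R}) :
  graph_ip A f g = moment (closed_walks A) (f * g).
Proof.
rewrite /graph_ip mulmxE -rmorphM /=; set h := f * g.
rewrite -[h in LHS]coefK poly_def !raddf_sum mulr_sumr.
apply: eq_bigr => k _ /=; rewrite linearZ rmorphXn /= horner_mx_X mxtraceZ.
by rewrite mulrCA.
Qed.

Variables (lam : 'I_d.+1 -> R) (m : 'I_d.+1 -> nat).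
Hypothesis specA : has_spectrum A lam m.

Lemma closed_walks_spectrum (l : nat) :
  closed_walks A l = n.+1%:R^-1 * \sum_(i < d.+1) (m i)%:R * lam i ^+ l.
Proof. by have [_ _ chiA] := specA; rewrite -(trace_exp_spectrum l chiA). Qed.

Lemma moment_spectrum (f : {poly R}) :
  moment (closed_walks A) f
    = n.+1%:R^-1 * \sum_(i < d.+1) (m i)%:R * f.[lam i].
Proof.
under [in RHS]eq_bigr => i _ do rewrite horner_coef mulr_sumr.
rewrite exchange_big mulr_sumr; apply: eq_bigr => k _ /=.
rewrite closed_walks_spectrum mulrCA mulr_sumr; congr (_ * _).
by apply: eq_bigr => i _; rewrite mulrCA.
Qed.

(** [<f, f>] is a sum of squares [f(lam i) ^ 2] with positive weights, and a
polynomial of degree at most [d] with [d+1] distinct roots is zero. *)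
Lemma graph_ip_definite (f : {poly R}) :
  (size f <= d.+1)%N -> graph_ip A f f = 0 -> f = 0.
Proof.
have [lam_decr m_gt0 _] := specA; move=> size_f.
rewrite graph_ipE moment_spectrum => /eqP.
rewrite mulf_eq0 invr_eq0 pnatr_eq0 /= psumr_eq0 => [|i _]; last first.
  by rewrite hornerM mulr_ge0 ?ler0n // -expr2 sqr_ge0.
move=> /allP f_roots; have lam_inj : injective lam.
  move=> i j eq_lam; apply/val_inj.
  by case: (ltngtP i j) => // /lam_decr; rewrite eq_lam ltxx.
apply: (@roots_geq_poly_eq0 _ _ [seq lam i | i : 'I_d.+1]).
- apply/allP => _ /imageP[i _ ->]; apply/eqP.
  have /= := f_roots i (mem_index_enum i).
  by rewrite hornerM !mulf_eq0 pnatr_eq0 gtn_eqF //= orbb => /eqP.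
- by rewrite map_inj_uniq ?enum_uniq.
- by rewrite size_map -cardE card_ord.
Qed.

End GraphMoments.

(** * The three-term recurrence *)

Record recurrence_data (R : rcfType) := RecurrenceData {
  point : R;
  moments : nat -> R;
  diam : nat;
  basis : nat -> {poly R};
  ralpha : nat -> R;
  rbeta : nat -> R;
  rgamma : nat -> R
}.

(** The properties of the predistance polynomials from which the
preintersection numbers are computed, stated for an arbitrary moment functional
and point.  For a graph, the remainder [r] of the last recurrence is a multiple
of the minimal polynomial of [A], so it vanishes at [lam0] and is orthogonal to
every polynomial. *)
Record predistance_recurrence (R : rcfType) (x : recurrence_data R) : Prop :=
  PredistanceRecurrence {
  moment0_eq1 : moments x 0 = 1;
  size_basis : forall i, (i <= diam x)%N -> size (basis x i) = i.+1;
  basis_orthogonal : forall i j, (i <= diam x)%N -> (j <= diam x)%N -> i != j ->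
    moment (moments x) (basis x i * basis x j) = 0;
  basis_norm : forall i, (i <= diam x)%N ->
    moment (moments x) (basis x i * basis x i) = (basis x i).[point x];
  basis_point_neq0 : forall i, (i <= diam x)%N -> (basis x i).[point x] != 0;
  recurrence_step : forall i, (i < diam x)%N ->
    'X * basis x i = lower_term (basis x) (rbeta x) i + ralpha x i *: basis x i
                       + rgamma x i.+1 *: basis x i.+1;
  recurrence_last : exists2 r : {poly R},
    'X * basis x (diam x) = lower_term (basis x) (rbeta x) (diam x)
                       + ralpha x (diam x) *: basis x (diam x) + r
    & r.[point x] = 0 /\ forall g, moment (moments x) (r * g) = 0;
  beta_last : rbeta x (diam x) = 0
}.

Section Recurrence.

Variables (R : rcfType) (x : recurrence_data R).
Hypothesis Px : predistance_recurrence x.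

Local Notation L := (moment (moments x)).
Local Notation pt := (point x).
Local Notation d := (diam x).
Local Notation p := (basis x).
Local Notation alpha := (ralpha x).
Local Notation beta := (rbeta x).
Local Notation gamma := (rgamma x).

(** Puts the last recurrence on the same footing as the others: either way,
what remains after the first two terms is orthogonal to [p_0, ..., p_i]. *)
Lemma recurrence_remainder (i : nat) : (i <= d)%N ->
  exists2 r : {poly R}, 'X * p i = lower_term p beta i + alpha i *: p i + r
    & forall j, (j <= i)%N -> L (r * p j) = 0.
Proof.
rewrite leq_eqVlt => /predU1P[->|lt_id].
  by have [r Dr [_ r0]] := recurrence_last Px; exists r.
exists (gamma i.+1 *: p i.+1); first exact: recurrence_step.
move=> j le_ji; rewrite -scalerAl linearZ /=.
by rewrite (basis_orthogonal Px) ?mulr0 ?(leq_trans le_ji) ?gtn_eqF // ltnW.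
Qed.

Lemma lower_term_orthogonal (i j : nat) : (i <= d)%N -> (i <= j <= d)%N ->
  L (lower_term p beta i * p j) = 0.
Proof.
case: i => [|i] le_id /andP[lt_ij le_jd] /=; first by rewrite mul0r raddf0.
rewrite -scalerAl linearZ /= (basis_orthogonal Px) ?mulr0 ?(ltnW le_id) //.
by rewrite ltn_eqF.
Qed.

Lemma alpha_norm (i : nat) : (i <= d)%N ->
  L ('X * p i * p i) = alpha i * (p i).[pt].
Proof.
move=> le_id; have [r -> r_orth] := recurrence_remainder le_id.
rewrite !mulrDl !raddfD /= r_orth // lower_term_orthogonal ?leqnn //.
by rewrite -scalerAl linearZ /= (basis_norm Px) // add0r addr0.
Qed.

(** Both sides are [<'X p_i, p_{i+1}>], computed by moving ['X] to either
factor and using the recurrence there. *)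
Lemma beta_norm (i : nat) : (i < d)%N ->
  gamma i.+1 * (p i.+1).[pt] = beta i * (p i).[pt].
Proof.
move=> lt_id; have le_id := ltnW lt_id.
have <- : L ('X * p i * p i.+1) = gamma i.+1 * (p i.+1).[pt].
  rewrite (recurrence_step Px) // !mulrDl !raddfD /=.
  rewrite lower_term_orthogonal ?leqnSn //.
  rewrite -!scalerAl !linearZ /= (basis_norm Px) //.
  by rewrite (basis_orthogonal Px) ?ltn_eqF // mulr0 !add0r.
rewrite -mulrA mulrCA mulrC; have [r -> r_orth] := recurrence_remainder lt_id.
rewrite /= !mulrDl !raddfD /= r_orth // -!scalerAl !linearZ /=.
rewrite (basis_norm Px) // (basis_orthogonal Px) ?gtn_eqF //.
by rewrite mulr0 !addr0.
Qed.

(** Otherwise the recurrence would bound the degree of ['X p_i] by [i]. *)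
Lemma gamma_neq0 (i : nat) : (i < d)%N -> gamma i.+1 != 0.
Proof.
move=> lt_id; have le_id := ltnW lt_id; apply/eqP => gamma0.
have p_neq0 : p i != 0 by rewrite -size_poly_eq0 (size_basis Px).
suff: (size ('X * p i)%R <= i.+1)%N.
  by rewrite mulrC size_mulX // (size_basis Px) // ltnn.
rewrite (recurrence_step Px) // gamma0 scale0r addr0.
rewrite (leq_trans (size_polyD _ _)) // geq_max.
rewrite (leq_trans (size_scale_leq _ _)) ?(size_basis Px) // andbT.
case: (i) le_id => [|j] lt_jd /=; first by rewrite size_poly0.
by rewrite (leq_trans (size_scale_leq _ _)) ?(size_basis Px) // ltnW.
Qed.

(** The coefficient [gamma_i], with the value 0 for [i = 0] that makes
[beta_eq] uniform. *)
Definition gamma_below (i : nat) : R := if i is j.+1 then gamma j.+1 else 0.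

(** The recurrence for [i] at [lam0], where [beta_norm] turns its outer terms
into [gamma_i p_i(lam0)] and [beta_i p_i(lam0)]. *)
Lemma beta_eq (i : nat) : (i <= d)%N ->
  beta i = pt - alpha i - gamma_below i.
Proof.
move=> le_id; apply: (mulIf (basis_point_neq0 Px le_id)).
have lowerE : (lower_term p beta i).[pt] = gamma_below i * (p i).[pt].
  case: i le_id => [|j] lt_jd /=; first by rewrite horner0 mul0r.
  by rewrite hornerZ beta_norm.
suff: pt * (p i).[pt] = (gamma_below i + alpha i + beta i) * (p i).[pt].
  by rewrite !mulrBl => ->; ring.
have XE : pt * (p i).[pt] = ('X * p i).[pt] by rewrite hornerM hornerX.
rewrite XE !mulrDl -lowerE; have [lt_id|ge_id] := ltnP i d.
  by rewrite (recurrence_step Px) // !hornerD !hornerZ beta_norm.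
have {ge_id} Di : i = d by apply/eqP; rewrite eqn_leq le_id.
have [r Dr [r0 _]] := recurrence_last Px.
by rewrite Di Dr !hornerD hornerZ r0 (beta_last Px) mul0r.
Qed.

(** The multiple of [p_{i+1}] that the recurrence produces from data of index
at most [i]. *)
Definition next_unscaled (i : nat) : {poly R} :=
  'X * p i - lower_term p beta i - alpha i *: p i.

Lemma next_unscaledE (i : nat) : (i < d)%N ->
  next_unscaled i = gamma i.+1 *: p i.+1.
Proof.
by move=> lt_id; rewrite /next_unscaled (recurrence_step Px) //; ring.
Qed.

Lemma next_unscaled_point_neq0 (i : nat) : (i < d)%N ->
  (next_unscaled i).[pt] != 0.
Proof.
move=> lt_id; rewrite next_unscaledE // hornerZ.
by rewrite mulf_neq0 ?gamma_neq0 ?(basis_point_neq0 Px).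
Qed.

(** With [q = gamma p], the normalization [<p, p> = p(lam0)] reads
[<q, q> = gamma q(lam0)], which determines [gamma] from [q]. *)
Lemma next_unscaled_norm (i : nat) : (i < d)%N ->
  L (next_unscaled i * next_unscaled i) = gamma i.+1 * (next_unscaled i).[pt].
Proof.
move=> lt_id; rewrite next_unscaledE // -scalerAl -scalerAr !linearZ /=.
by rewrite (basis_norm Px) // hornerZ.
Qed.

Lemma gamma_eq (i : nat) : (i < d)%N ->
  gamma i.+1 = L (next_unscaled i * next_unscaled i) / (next_unscaled i).[pt].
Proof.
by move=> lt_id; rewrite next_unscaled_norm // mulfK ?next_unscaled_point_neq0.
Qed.

(** The coefficient [alpha] is insensitive to scaling, so the formula of
[alpha_norm] also holds for [next_unscaled]; this avoids knowing
[gamma_{i+1}]. *)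
Lemma alpha_next_norm (i : nat) : (i < d)%N ->
  L ('X * next_unscaled i * next_unscaled i)
    = alpha i.+1 * L (next_unscaled i * next_unscaled i).
Proof.
move=> lt_id; rewrite next_unscaledE // -!(scalerAl, scalerAr) !linearZ /=.
by rewrite alpha_norm // (basis_norm Px) //; ring.
Qed.

Lemma basis0 : p 0 = 1.
Proof.
have size_p0 := size_basis Px (leq0n d).
have norm_p0 := basis_norm Px (leq0n d).
have /size_poly1P[a a_neq0 Da] : size (p 0) == 1 by rewrite size_p0.
move: norm_p0; rewrite Da hornerC -polyCM -[_%:P]mulr1 -(expr0 'X) momentCXn.
rewrite (moment0_eq1 Px) mulr1 -[in RHS](mulr1 a) => /(mulfI a_neq0) ->.
by rewrite expr0.
Qed.

(** ** The first values *)

Section FirstValues.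

Local Notation c := (moments x).
Hypotheses (d_gt0 : (0 < d)%N) (c1_eq0 : c 1%N = 0).

Lemma alpha0_eq0 : alpha 0 = 0.
Proof.
have := alpha_norm (leq0n d).
rewrite basis0 !mulr1 hornerC mulr1 -[_ 'X]/(L 'X^1) -(mul1r 'X^1) => <-.
by rewrite momentCXn c1_eq0 mulr0.
Qed.

Lemma beta0_eq : beta 0 = pt.
Proof. by rewrite beta_eq // alpha0_eq0 !subr0. Qed.

Lemma next_unscaled0 : next_unscaled 0 = 'X.
Proof. by rewrite /next_unscaled /= basis0 alpha0_eq0 scale0r !subr0 mulr1. Qed.

Lemma point_neq0 : pt != 0.
Proof.
by have := next_unscaled_point_neq0 d_gt0; rewrite next_unscaled0 hornerX.
Qed.

Lemma next_unscaled0_norm : L (next_unscaled 0 * next_unscaled 0) = c 2.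
Proof. by rewrite next_unscaled0 -expr2 -(mul1r ('X ^+ 2)) momentCXn mul1r. Qed.

Lemma gamma1_eq : gamma 1 = c 2 / pt.
Proof. by rewrite gamma_eq // next_unscaled0_norm next_unscaled0 hornerX. Qed.

Lemma moment2_neq0 : c 2 != 0.
Proof.
have := gamma_neq0 d_gt0; rewrite gamma1_eq.
by apply: contraNneq => ->; rewrite mul0r.
Qed.

Lemma alpha1_eq : alpha 1 = c 3 / c 2.
Proof.
have := alpha_next_norm d_gt0; rewrite next_unscaled0_norm next_unscaled0.
rewrite -expr2 -exprSr -(mul1r ('X ^+ 3)) momentCXn mul1r => ->.
by rewrite mulfK ?moment2_neq0.
Qed.

Hypothesis d_gt1 : (1 < d)%N.

Local Notation b := (pt / c 2).

Local Notation a := (c 3 / c 2).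

Lemma next_unscaled1 :
  next_unscaled 1 = b%:P * ('X ^+ 2 - a%:P * 'X - (c 2)%:P).
Proof.
have c2_neq0 := moment2_neq0; have pt_neq0 := point_neq0.
have p1E : p 1 = b%:P * 'X.
  apply: (scalerI (gamma_neq0 d_gt0)); rewrite -next_unscaledE //.
  rewrite next_unscaled0 -mul_polyC mulrA -polyCM gamma1_eq.
  by rewrite mulrA divfK // divff // mul1r.
rewrite /next_unscaled /= p1E basis0 alpha1_eq beta0_eq -!mul_polyC.
(* This lets the factor [b] be taken out of [beta 0 = pt] as well. *)
have -> : pt%:P = b%:P * (c 2)%:P by rewrite -polyCM divfK.
by ring.
Qed.

Lemma next_unscaled1_norm :
  L (next_unscaled 1 * next_unscaled 1)
    = b ^+ 2 * (c 4 - 2 * a * c 3 + (a ^+ 2 - 2 * c 2) * c 2 + c 2 ^+ 2).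
Proof.
rewrite next_unscaled1.
have -> : b%:P * ('X ^+ 2 - a%:P * 'X - (c 2)%:P)
            * (b%:P * ('X ^+ 2 - a%:P * 'X - (c 2)%:P))
          = (b ^+ 2)%:P * 'X^4 + (- 2 * a * b ^+ 2)%:P * 'X^3
            + ((a ^+ 2 - 2 * c 2) * b ^+ 2)%:P * 'X^2
            + (2 * a * c 2 * b ^+ 2)%:P * 'X^1
            + (c 2 ^+ 2 * b ^+ 2)%:P * 'X^0.
  by ring.
by rewrite !raddfD /= !momentCXn c1_eq0 (moment0_eq1 Px); ring.
Qed.

Lemma next_unscaled1_normX :
  L ('X * next_unscaled 1 * next_unscaled 1)
    = b ^+ 2
        * (c 5 - 2 * a * c 4 + (a ^+ 2 - 2 * c 2) * c 3 + 2 * a * c 2 ^+ 2).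
Proof.
rewrite next_unscaled1.
have -> : 'X * (b%:P * ('X ^+ 2 - a%:P * 'X - (c 2)%:P))
            * (b%:P * ('X ^+ 2 - a%:P * 'X - (c 2)%:P))
          = (b ^+ 2)%:P * 'X^5 + (- 2 * a * b ^+ 2)%:P * 'X^4
            + ((a ^+ 2 - 2 * c 2) * b ^+ 2)%:P * 'X^3
            + (2 * a * c 2 * b ^+ 2)%:P * 'X^2
            + (c 2 ^+ 2 * b ^+ 2)%:P * 'X^1.
  by ring.
by rewrite !raddfD /= !momentCXn c1_eq0; ring.
Qed.

Local Notation D := (c 2 * c 4 - c 3 ^+ 2 - c 2 ^+ 3).
Local Notation E := (pt ^+ 2 * c 2 - c 3 * pt - c 2 ^+ 2).

Lemma next_unscaled1_normE :
  L (next_unscaled 1 * next_unscaled 1) = b ^+ 2 / c 2 * D.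
Proof. by rewrite next_unscaled1_norm; have c2_neq0 := moment2_neq0; field. Qed.

Lemma next_unscaled1_pointE : (next_unscaled 1).[pt] = b / c 2 * E.
Proof.
rewrite next_unscaled1 !(hornerM, hornerD, hornerN, hornerC, hornerX, hornerXn).
by have c2_neq0 := moment2_neq0; field.
Qed.

Lemma gamma2_denominator_neq0 : c 2 * E != 0.
Proof.
rewrite mulf_neq0 ?moment2_neq0 //.
have := next_unscaled_point_neq0 d_gt1; rewrite next_unscaled1_pointE.
by apply: contraNneq => ->; rewrite mulr0.
Qed.

Lemma alpha2_denominator_neq0 : c 2 * D != 0.
Proof.
rewrite mulf_neq0 ?moment2_neq0 //.
have := gamma_neq0 d_gt1; rewrite gamma_eq // next_unscaled1_normE.
by apply: contraNneq => ->; rewrite mulr0 mul0r.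
Qed.

Lemma gamma2_eq : gamma 2 = pt * D / (c 2 * E).
Proof.
have := gamma2_denominator_neq0; rewrite mulf_eq0 => /norP[c2_neq0 E_neq0].
have := point_neq0; rewrite gamma_eq // next_unscaled1_normE.
rewrite next_unscaled1_pointE.
move: (D) => u; move: E E_neq0 => v v_neq0 pt_neq0.
by field; rewrite v_neq0 c2_neq0.
Qed.

Lemma alpha2_eq :
  alpha 2 = (c 2 ^+ 2 * c 5 - 2 * c 2 * c 3 * c 4 + c 3 ^+ 3) / (c 2 * D).
Proof.
have := alpha2_denominator_neq0; rewrite mulf_eq0 => /norP[c2_neq0 D_neq0].
have pt_neq0 := point_neq0.
have norm_neq0 : b ^+ 2 / c 2 * D != 0.
  by rewrite !mulf_neq0 ?invr_eq0.
apply: (mulIf norm_neq0).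
rewrite -{1}next_unscaled1_normE -alpha_next_norm // next_unscaled1_normX.
by field; rewrite c2_neq0 D_neq0.
Qed.

End FirstValues.

End Recurrence.

(** * Quantities computed by a fraction *)

Section RationalFunctions.

Variables (R : rcfType) (X : Type) (pt : X -> R) (c : X -> nat -> R) (N : nat).

Local Notation eval P x := (ratfun_eval P (pt x) (c x)).

Lemma ratfun_evalE (P : {mpoly int[N.+1]}) (x : X) :
  eval P x = mmap intr (@ratfun_args R N (pt x) (c x)) P.
Proof. by []. Qed.

Lemma ratfun_evalM (x : X) (P Q : {mpoly int[N.+1]}) :
  eval (P * Q) x = eval P x * eval Q x.
Proof. by rewrite !ratfun_evalE rmorphM. Qed.

Lemma ratfun_evalD (x : X) (P Q : {mpoly int[N.+1]}) :
  eval (P + Q) x = eval P x + eval Q x.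
Proof. by rewrite !ratfun_evalE rmorphD. Qed.

Lemma ratfun_evalC (x : X) (z : int) :
  eval (z%:MP : {mpoly int[N.+1]}) x = z%:~R.
Proof. by rewrite ratfun_evalE mmapC. Qed.

Lemma ratfun_evalX (x : X) (k : 'I_N.+1) :
  eval ('X_k : {mpoly int[N.+1]}) x = ratfun_args (pt x) (c x) k.
Proof. by rewrite ratfun_evalE mmapX mmap1U. Qed.

(** A quantity [phi] attached to each [x : X] that is given on [S] by a single
fraction.  It is a type, not a proposition, so that the fractions for all
indices can be collected into a function without choice; the number [N] of
walk variables is fixed, so that fractions combine without renaming them. *)
Definition rational (S : X -> Prop) (phi : X -> R) : Type :=
  {F : {mpoly int[N.+1]} * {mpoly int[N.+1]} |
    forall x, S x -> computed_by (RatFun F.1 F.2) (pt x) (c x) (phi x)}.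

Lemma rational_sub (S S' : X -> Prop) (phi : X -> R) :
  (forall x, S' x -> S x) -> rational S phi -> rational S' phi.
Proof. by move=> sS'S [F FS]; exists F => x /sS'S/FS. Qed.

Lemma rational_eq (S : X -> Prop) (phi psi : X -> R) :
  (forall x, S x -> phi x = psi x) -> rational S psi -> rational S phi.
Proof.
by move=> eq_phi [F FS]; exists F => x Sx; rewrite eq_phi //; apply: FS.
Qed.

Section Closure.

Variable S : X -> Prop.

Lemma rational_int (z : int) : rational S (fun=> z%:~R).
Proof.
exists (z%:MP, 1%:MP) => x _.
by split; rewrite /= !ratfun_evalC ?oner_eq0 // divr1.
Qed.

Lemma rational_arg (k : 'I_N.+1) :
  rational S (fun x => ratfun_args (pt x) (c x) k).
Proof.
exists ('X_k, 1%:MP) => x _; split; rewrite /= !ratfun_evalC ?oner_eq0 //.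
by rewrite divr1 ratfun_evalX.
Qed.

Lemma rational_point : rational S pt.
Proof. exact: (rational_arg ord0). Qed.

Lemma rational_moment (l : nat) : (l < N)%N -> rational S (c ^~ l).
Proof. by move=> lt_lN; exact: (rational_arg (lift ord0 (Ordinal lt_lN))). Qed.

Lemma rationalD (phi psi : X -> R) :
  rational S phi -> rational S psi -> rational S (fun x => phi x + psi x).
Proof.
move=> [[P Q] PQ] [[P' Q'] PQ']; exists (P * Q' + P' * Q, Q * Q') => x Sx.
have [/= Q_neq0 ->] := PQ x Sx; have [/= Q'_neq0 ->] := PQ' x Sx.
split; rewrite /= ?ratfun_evalD !ratfun_evalM ?mulf_neq0 //.
by rewrite addf_div.
Qed.

Lemma rationalM (phi psi : X -> R) :
  rational S phi -> rational S psi -> rational S (fun x => phi x * psi x).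
Proof.
move=> [[P Q] PQ] [[P' Q'] PQ']; exists (P * P', Q * Q') => x Sx.
have [/= Q_neq0 ->] := PQ x Sx; have [/= Q'_neq0 ->] := PQ' x Sx.
by split; rewrite /= !ratfun_evalM ?mulf_neq0 // mulf_div.
Qed.

Lemma rationalV (phi : X -> R) :
  (forall x, S x -> phi x != 0) -> rational S phi ->
  rational S (fun x => (phi x)^-1).
Proof.
move=> phi_neq0 [[P Q] PQ]; exists (Q, P) => x Sx.
have [/= Q_neq0 phiE] := PQ x Sx; split=> /=; last by rewrite phiE invf_div.
by have := phi_neq0 x Sx; rewrite phiE; apply: contraNneq => ->; rewrite mul0r.
Qed.

Lemma rationalB (phi psi : X -> R) :
  rational S phi -> rational S psi -> rational S (fun x => phi x - psi x).
Proof.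
move=> Fphi Fpsi; apply: rational_eq (fun x => phi x + (-1)%:~R * psi x) _ _.
  by move=> x _; rewrite rmorphN1 mulN1r.
exact: rationalD Fphi (rationalM (rational_int _) Fpsi).
Qed.

Lemma rational_sum (n : nat) (phi : nat -> X -> R) :
  (forall k, (k < n)%N -> rational S (phi k)) ->
  rational S (fun x => \sum_(k < n) phi k x).
Proof.
elim: n => [|n IHn] Fphi.
  by apply: rational_eq (rational_int 0) => x _; rewrite big_ord0.
apply: rational_eq (fun x _ => big_ord_recr _ _) _.
by apply: rationalD (Fphi n (leqnn _)); apply: IHn => k /ltnW/Fphi.
Qed.

Definition rational_poly (f : X -> {poly R}) : Type :=
  forall k, rational S (fun x => (f x)`_k).

Lemma rational_polyC (phi : X -> R) :
  rational S phi -> rational_poly (fun x => (phi x)%:P).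
Proof.
move=> Fphi [|k].
  by apply: rational_eq Fphi => x _; rewrite coefC.
by apply: rational_eq (rational_int 0) => x _; rewrite coefC.
Qed.

Lemma rational_polyX : rational_poly (fun=> 'X).
Proof.
move=> k; apply: rational_eq (rational_int (k == 1%N)) => x _.
by rewrite coefX; case: eqP.
Qed.

Lemma rational_polyM (f g : X -> {poly R}) :
  rational_poly f -> rational_poly g -> rational_poly (fun x => f x * g x).
Proof.
move=> Ff Fg k; apply: rational_eq (fun x _ => coefM _ _ _) _.
apply: rational_sum (fun j x => (f x)`_j * (g x)`_(k - j)) _ => j _.
exact: rationalM.
Qed.

Lemma rational_polyB (f g : X -> {poly R}) :
  rational_poly f -> rational_poly g -> rational_poly (fun x => f x - g x).
Proof.
move=> Ff Fg k; apply: rational_eq (fun x _ => coefB _ _ _) _.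
exact: rationalB.
Qed.

Lemma rational_polyZ (phi : X -> R) (f : X -> {poly R}) :
  rational S phi -> rational_poly f -> rational_poly (fun x => phi x *: f x).
Proof.
move=> Fphi Ff k; apply: rational_eq (fun x _ => coefZ _ _ _) _.
exact: rationalM.
Qed.

Lemma rational_poly_moment (n : nat) (f : X -> {poly R}) :
  (n <= N)%N -> (forall x, S x -> (size (f x) <= n)%N) ->
  rational_poly f -> rational S (fun x => moment (c x) (f x)).
Proof.
move=> le_nN size_f Ff.
apply: rational_eq (fun x Sx => moment_wide (c x) (size_f x Sx)) _.
apply: rational_sum (fun k x => (f x)`_k * c x k) _ => k lt_kn.
by apply: rationalM (Ff k) (rational_moment (leq_trans lt_kn le_nN)).
Qed.

Lemma rational_poly_horner (n : nat) (f : X -> {poly R}) :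
  (forall x, S x -> (size (f x) <= n)%N) ->
  rational_poly f -> rational S (fun x => (f x).[pt x]).
Proof.
move=> size_f Ff.
apply: rational_eq (fun x Sx => horner_coef_wide (pt x) (size_f x Sx)) _.
apply: rational_sum (fun k x => (f x)`_k * pt x ^+ k) _ => k _.
apply: rationalM (Ff k) _; elim: k => [|k IHk].
  by apply: rational_eq (rational_int 1) => x _; rewrite expr0.
apply: rational_eq (fun x _ => exprS _ _) _.
exact: rationalM rational_point IHk.
Qed.

End Closure.

End RationalFunctions.

(** * The preintersection numbers are rational functions *)

Section Computability.

Variables (R : rcfType) (N : nat).

(** The data on which the formulas for index [i] make sense. *)
Definition reaches (i : nat) (x : recurrence_data R) : Prop :=
  predistance_recurrence x /\ (i <= diam x)%N.

Local Notation rational := (rational (@point R) (@moments R) N).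
Local Notation rational_poly := (rational_poly (@point R) (@moments R) N).

Lemma reachesW (i : nat) (x : recurrence_data R) :
  reaches i.+1 x -> reaches i x.
Proof. by case=> Px /ltnW. Qed.

(** The bound on [N] comes from the degree [2 i + 1] of ['X p_i p_i], whose
moment involves [c 0, ..., c (2 i + 1)]. *)
Lemma rational_alpha_of (i : nat) :
  (i.*2.+2 <= N)%N -> rational_poly (reaches i) (fun x => basis x i) ->
  rational (reaches i) (fun x => ralpha x i).
Proof.
move=> le_iN Fp.
apply: rational_eq (fun x => moment (moments x) ('X * basis x i * basis x i)
                               * (basis x i).[point x]^-1) _ _.
  move=> x [Px le_id].
  by rewrite (alpha_norm Px) // mulfK ?(basis_point_neq0 Px).
apply: rationalM.
  apply: (rational_poly_moment le_iN) => [x [Px le_id]|]; last first.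
    exact: rational_polyM (rational_polyM (rational_polyX _ _ _ _) Fp) Fp.
  rewrite (leq_trans (size_polyMleq _ _)) // mulrC size_mulX.
    by rewrite (size_basis Px) // !addSn addnS addnn.
  by rewrite -size_poly_eq0 (size_basis Px).
apply: rationalV => [x [Px le_id]|]; first exact: basis_point_neq0.
apply: (@rational_poly_horner _ _ _ _ _ _ i.+1) Fp => x [Px le_id].
by rewrite (size_basis Px).
Qed.

Lemma rational_beta_of (i : nat) :
  rational (reaches i) (fun x => ralpha x i) ->
  rational (reaches i) (fun x => gamma_below x i) ->
  rational (reaches i) (fun x => rbeta x i).
Proof.
move=> Falpha Fgamma.
apply: rational_eq (fun x => point x - ralpha x i - gamma_below x i) _ _.
  by move=> x [Px le_id]; rewrite (beta_eq Px).
by apply: rationalB Fgamma; apply: rationalB Falpha; apply: rational_point.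
Qed.

Lemma size_next_unscaled (x : recurrence_data R) (i : nat) :
  reaches i.+1 x -> (size (next_unscaled x i) <= i.+2)%N.
Proof.
move=> [Px lt_id]; rewrite (next_unscaledE Px) //.
by rewrite (leq_trans (size_scale_leq _ _)) // (size_basis Px).
Qed.

(** The lower term and [gamma_below] are carried along with [p_i] because they
are what the formulas for [alpha_i], [beta_i] and [next_unscaled] need beyond
[p_i].  The restriction to [reaches i] keeps every divisor nonzero. *)
Lemma rational_recurrence (i : nat) : (i.*2.+2 <= N)%N ->
  (rational_poly (reaches i) (fun x => basis x i)
   * rational_poly (reaches i) (fun x => lower_term (basis x) (rbeta x) i)
   * rational (reaches i) (fun x => gamma_below x i))%type.
Proof.
elim: i => [|i IHi] le_iN.
  split; [split|]; last exact: (rational_int _ _ _ _ 0).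
  - move=> k.
    apply: rational_eq (rational_polyC (rational_int _ _ _ _ 1) k) => x [Px _].
    by rewrite (basis0 Px).
  - exact: rational_polyC (rational_int _ _ _ _ 0).
have le_iN' : (i.*2.+2 <= N)%N.
  by apply: leq_trans le_iN; rewrite doubleS !ltnS leqW.
have [[Fp Flower] Fgamma] := IHi le_iN'.
have Falpha := rational_alpha_of le_iN' Fp.
have Fbeta := rational_beta_of Falpha Fgamma.
have Fq : rational_poly (reaches i.+1) (fun x => next_unscaled x i).
  move=> k; apply: rational_sub (@reachesW i) _; move: k.
  apply: rational_polyB (rational_polyZ Falpha Fp).
  exact: rational_polyB (rational_polyM (rational_polyX _ _ _ _) Fp) Flower.
have Fgamma' : rational (reaches i.+1) (fun x => gamma_below x i.+1).
  apply: rational_eq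
    (fun x => moment (moments x) (next_unscaled x i * next_unscaled x i)
                * (next_unscaled x i).[point x]^-1) _ _.
    by move=> x [Px lt_id]; rewrite -(gamma_eq Px).
  apply: rationalM.
    apply: (@rational_poly_moment _ _ _ _ _ _ i.+1.*2.+1)
      (rational_polyM Fq Fq).
      exact: ltnW.
    move=> x Sx; have le_q := size_next_unscaled Sx.
    rewrite (leq_trans (size_polyMleq _ _)) // -subn1 leq_subLR add1n.
    by rewrite (leq_trans (leq_add le_q le_q)) // addSn addnS addnn.
  apply: rationalV => [x [Px lt_id]|]; first exact: next_unscaled_point_neq0.
  exact: rational_poly_horner (@size_next_unscaled^~ i) Fq.
split; [split|] => //.
- have Fp' := rational_polyZ (rationalV _ Fgamma') Fq => k.
  apply: rational_eq (Fp' _ k) => x [Px lt_id]; last exact: gamma_neq0.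
  by rewrite (next_unscaledE Px) // scalerA mulVf ?scale1r ?(gamma_neq0 Px).
- by move=> k; apply: rational_sub (@reachesW i) (rational_polyZ Fbeta Fp k).
Qed.

End Computability.

Section Formulas.

Variable R : rcfType.

Lemma ralpha_ratfun (i : nat) : {F : ratfun |
  forall x : recurrence_data R, reaches i x ->
    computed_by F (point x) (moments x) (ralpha x i)}.
Proof.
have [[Fp _] _] := rational_recurrence R (leqnn i.*2.+2).
by have [F HF] := rational_alpha_of (leqnn _) Fp; exists (RatFun F.1 F.2).
Qed.

Lemma rbeta_ratfun (i : nat) : {F : ratfun |
  forall x : recurrence_data R, reaches i x ->
    computed_by F (point x) (moments x) (rbeta x i)}.
Proof.
have [[Fp _] Fgamma] := rational_recurrence R (leqnn i.*2.+2).
have Falpha := rational_alpha_of (leqnn _) Fp.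
by have [F HF] := rational_beta_of Falpha Fgamma; exists (RatFun F.1 F.2).
Qed.

Lemma rgamma_ratfun (i : nat) : {F : ratfun |
  forall x : recurrence_data R, reaches i x ->
    computed_by F (point x) (moments x) (gamma_below x i)}.
Proof.
have [_ [F HF]] := rational_recurrence R (leqnn i.*2.+2).
by exists (RatFun F.1 F.2).
Qed.

End Formulas.

(** * The predistance polynomials of a graph *)

Lemma predistance_recurrence_graph (R : rcfType) (n d : nat) (A : 'M[R]_n.+1)
    (lam : 'I_d.+1 -> R) (m : 'I_d.+1 -> nat) (p : nat -> {poly R})
    (alpha beta gamma : nat -> R) :
  has_spectrum A lam m -> predistance_polynomials A lam p ->
  preintersection_numbers lam p alpha beta gamma ->
  predistance_recurrence
    (RecurrenceData (lam ord0) (closed_walks A) d p alpha beta gamma).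
Proof.
move=> specA [size_p orth_p norm_p] [step_p last_p beta_d].
split=> //= [|i j le_id le_jd ij|i le_id|i le_id|].
- by rewrite /closed_walks expr0 mxtrace1 mulVf ?pnatr_eq0.
- by rewrite -graph_ipE orth_p.
- by rewrite -graph_ipE norm_p.
- rewrite -norm_p //; apply/negP => /eqP /(graph_ip_definite specA).
  rewrite size_p // ltnS => /(_ le_id) p_eq0.
  by have := size_p i le_id; rewrite p_eq0 size_poly0.
exists ('X * p d - (lower_term p beta d + alpha d *: p d)); first by ring.
have r0 (i : 'I_d.+1) :
    ('X * p d - (lower_term p beta d + alpha d *: p d)).[lam i] = 0.
  apply/eqP; rewrite -[_ == 0]/(root _ _) -dvdp_XsubCl.
  apply: dvdp_trans last_p; rewrite /minimal_polynomial (bigD1 i) //=.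
  exact: dvdp_mulr.
split=> // g; rewrite (moment_spectrum specA) big1 ?mulr0 // => i _.
by rewrite hornerM r0 mul0r mulr0.
Qed.

Theorem proposition3p7 (R : rcfType) :
  exists Falpha Fbeta Fgamma : nat -> ratfun,
  forall (n : nat) (e : rel 'I_n.+1) (d : nat)
         (lam : 'I_d.+1 -> R) (m : 'I_d.+1 -> nat)
         (p : nat -> {poly R}) (alpha beta gamma : nat -> R),
  let A := adjacency R e in
  let lam0 := lam ord0 in
  let c := closed_walks A in
  connected_simple_graph e ->
  (1 <= d)%N ->
  has_spectrum A lam m ->
  predistance_polynomials A lam p ->
  preintersection_numbers lam p alpha beta gamma ->
  [/\ forall l, c l = n.+1%:R^-1 * \sum_(i < d.+1) (m i)%:R * lam i ^+ l,
      [/\ forall i, (i <= d)%N -> computed_by (Falpha i) lam0 c (alpha i),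
          forall i, (i <= d)%N -> computed_by (Fbeta i) lam0 c (beta i)
        & forall i, (1 <= i <= d)%N -> computed_by (Fgamma i) lam0 c (gamma i)],
      alpha 0%N = 0 /\ beta 0%N = lam0,
      [/\ lam0 != 0, c 2%N != 0,
          gamma 1%N = c 2%N / lam0,
          alpha 1%N = c 3%N / c 2%N
        & beta 1%N = lam0 - alpha 1%N - gamma 1%N]
    & (2 <= d)%N ->
      [/\ c 2%N * (lam0 ^+ 2 * c 2%N - c 3%N * lam0 - c 2%N ^+ 2) != 0,
          gamma 2%N = lam0 * (c 2%N * c 4%N - c 3%N ^+ 2 - c 2%N ^+ 3)
                    / (c 2%N * (lam0 ^+ 2 * c 2%N - c 3%N * lam0 - c 2%N ^+ 2)),
          c 2%N * (c 2%N * c 4%N - c 3%N ^+ 2 - c 2%N ^+ 3) != 0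
        & alpha 2%N = (c 2%N ^+ 2 * c 5%N - 2 * c 2%N * c 3%N * c 4%N + c 3%N ^+ 3)
                    / (c 2%N * (c 2%N * c 4%N - c 3%N ^+ 2 - c 2%N ^+ 3))]].
Proof.
exists (fun i => sval (ralpha_ratfun R i)), (fun i => sval (rbeta_ratfun R i)),
  (fun i => sval (rgamma_ratfun R i)).
move=> n e d lam m p alpha beta gamma A lam0 c.
move=> graph_e d_gt0 specA pred_p preint.
have Px := predistance_recurrence_graph specA pred_p preint.
have c1 : c 1%N = 0.
  have [_ irr_e _] := graph_e.
  rewrite /c /closed_walks expr1 /mxtrace big1 ?mulr0 // => i _.
  by rewrite mxE irr_e.
split=> [l||||d_gt1].
- exact: closed_walks_spectrum.
- split=> [i le_id|i le_id|[//|i] /= le_id].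
  + exact: (svalP (ralpha_ratfun R i) _ (conj Px le_id)).
  + exact: (svalP (rbeta_ratfun R i) _ (conj Px le_id)).
  + exact: (svalP (rgamma_ratfun R i.+1) _ (conj Px le_id)).
- by split; [exact: (alpha0_eq0 Px) | exact: (beta0_eq Px)].
- split; [exact: (point_neq0 Px) | exact: (moment2_neq0 Px)
         | exact: (gamma1_eq Px) | exact: (alpha1_eq Px) | exact: (beta_eq Px)].
- split; [exact: (gamma2_denominator_neq0 Px) | exact: (gamma2_eq Px)
         | exact: (alpha2_denominator_neq0 Px) | exact: (alpha2_eq Px)].
Qed.
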